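(* Let $f:\mathbb{R}^p\to\mathbb{R}\cup\{+\infty\}$ and $g:\mathbb{R}^n\to\mathbb{R}\cup\{+\infty\}$ be proper, closed and convex, let $K:\mathbb{R}^p\to\mathbb{R}^n$ be linear, assume that the solution set of the primal problem $F^\star=\min_{x}\{F(x):=f(x)+g(Kx)\}$ is nonempty and that $0\in\mathrm{ri}(\mathrm{dom}(g)-K\,\mathrm{dom}(f))$. Assume also that $f$ is $\mu_f$-strongly convex with $\mu_f>0$ (not necessarily smooth). Let $x^\star$ be an optimal solution of the primal problem and $y^\star$ an optimal solution of the dual problem $\min_y\{f^*(-K^\top y)+g^*(y)\}$. Let $\gamma\in(\frac12,1)$, $\Gamma:=2-\frac1\gamma$, $c>2$, $\rho_0\in\left(0,\frac{c(c-1)\Gamma\mu_f}{(2c-1)\|K\|^2}\right]$, and let $\{x^k\}$ be generated by Algorithm 2 (defined in the context) with $\tau_k:=\frac{c}{k+c}$. Then for all $k\ge1$, $$0\le\widetilde{\mathcal{L}}(x^k,y^\star)-F^\star\le\frac{R_0^2}{(k+c-1)^2}\qquad\text{and}\qquad\liminf_{k\to\infty}\;k^2\log(k)\left[\widetilde{\mathcal{L}}(x^k,y^\star)-F^\star\right]=0,$$ where $$R_0^2:=(c-1)[F(x^0)-F^\star]+\frac{c-1}{2}\left[\frac{(c-1)\rho_0\|K\|^2}{\Gamma}+c\mu_f\right]\|x^0-x^\star\|^2+\frac{c^2}{2(1-\gamma)\rho_0}\|y^0-y^\star\|^2.$$ Moreover, if $g$ is $M_g$-Lipschitz continuous on $\mathrm{dom}(g)$,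 then for all $k\ge1$, $$0\le F(x^k)-F^\star\le\frac{R_1^2}{(k+c-1)^2}\qquad\text{and}\qquad\liminf_{k\to\infty}\;k^2\sqrt{\log k}\,[F(x^k)-F^\star]=0,$$ where $R_1^2:=R_0^2+\sqrt{2c^2/\rho_0}\,(\|y^\star\|+M_g)R_0$.
   Context: $f^*,g^*$ are Fenchel conjugates; $\mathrm{ri}$ is the relative interior; $\|K\|$ is the operator norm; $\mathrm{prox}_h(x):=\arg\min_y\{h(y)+\frac12\|y-x\|^2\}$. $f$ is $\mu_f$-strongly convex if $f-\frac{\mu_f}{2}\|\cdot\|^2$ is convex. A function $h$ is $M$-Lipschitz continuous on $\mathrm{dom}(h)=\{x: h(x)<+\infty\}$, with $M\in[0,+\infty)$, if $|h(x)-h(y)|\le M\|x-y\|$ for all $x,y\in\mathrm{dom}(h)$. Lagrange function: $\widetilde{\mathcal{L}}(x,y):=f(x)+\langle Kx,y\rangle-g^*(y)$. Algorithm 2. Inputs: $x^0\in\mathbb{R}^p$, $y^0\in\mathbb{R}^n$, $\gamma\in(\frac12,1)$, $\Gamma:=2-\frac1\gamma$, $\rho_0>0$, and a sequence $\{\tau_k\}$ with $\tau_0=1$ (as specified in the claim). Set $\hat x^0:=\tilde x^0:=x^0$, $\tilde y^{-1}:=\tilde y^0:=\bar y^0:=y^0$. For $k=0,1,2,\dots$: 1. $\rho_k:=\frac{\rho_0}{\tau_k^2}$, $\beta_k:=\frac{\Gamma}{\rho_k\|K\|^2}$, $\eta_k:=(1-\gamma)\rho_k$. 2. $y^{k+1}:=\mathrm{prox}_{\rho_kg^*}(\tilde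 y^k+\rho_kK\hat x^k)$; $\tilde x^{k+1}:=\mathrm{prox}_{(\beta_k/\tau_k)f}\left(\tilde x^k-\frac{\beta_k}{\tau_k}K^\top y^{k+1}\right)$; $x^{k+1}:=\mathrm{prox}_{f/(\rho_k\|K\|^2)}\left(\hat x^k-\frac{1}{\rho_k\|K\|^2}K^\top y^{k+1}\right)$; $\hat x^{k+1}:=(1-\tau_{k+1})x^{k+1}+\tau_{k+1}\tilde x^{k+1}$. 3. $\tilde y^{k+1}:=\tilde y^k+\eta_kK[x^{k+1}-\hat x^k-(1-\tau_k)(x^k-\hat x^{k-1})]+(1-\gamma)\left[y^{k+1}-\tilde y^k-\frac{\tau_{k-1}^2(1-\tau_k)}{\tau_k^2}(y^k-\tilde y^{k-1})\right]$. 4. $\bar y^{k+1}:=(1-\tau_k)\bar y^k+\tau_ky^{k+1}$. At $k=0$ the terms in step 3 multiplied by $1-\tau_0=0$ vanish.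
   Formalization: The Lipschitz part fails as stated if Kx^k leaves dom(g), since then F(x^k)=+∞: its upper bound is proved for those k with Kx^k in dom(g), its liminf when Kx^k is in dom(g) for all large k; both conditions are automatic if dom(g)=R^n. *)

(* Defs.v *)
From HB Require Import structures.
From mathcomp Require Import all_boot all_order all_algebra.
From mathcomp Require Import all_classical all_reals all_analysis.

Set Implicit Arguments.
Unset Strict Implicit.
Unset Printing Implicit Defensive.

Import Order.TTheory GRing.Theory Num.Theory.
Import numFieldTopology.Exports.

Local Open Scope classical_set_scope.
Local Open Scope ring_scope.

Section Euclidean.
Context {R : realType}.

Definition dot {n} (u v : 'cV[R]_n) : R := \sum_(i < n) u i 0 * v i 0.

(* The library's norm `|u| on matrices is the max norm, hence this one. *)
Definition enorm {n} (u : 'cV[R]_n) : R := Num.sqrt (dot u u).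

Definition opnorm {m n} (A : 'M[R]_(m, n)) : R :=
  sup [set enorm (A *m x) | x in [set x : 'cV[R]_n | enorm x <= 1]].

Definition affine_hull {n} (A : set 'cV[R]_n) : set 'cV[R]_n :=
  [set z | exists (m : nat) (a : 'I_m -> 'cV[R]_n) (l : 'I_m -> R),
    [/\ forall i, A (a i), \sum_(i < m) l i = 1 & z = \sum_(i < m) l i *: a i]].

(* The product topology on 'cV[R]_n is the Euclidean one. *)
Definition relint {n} (A : set 'cV[R]_n) : set 'cV[R]_n :=
  [set z | affine_hull A z /\ within (affine_hull A) (nbhs z) A].

End Euclidean.

(* Functions with values in R ∪ {+oo} are functions into \bar R that never
   take the value -oo; the latter is part of [proper_fun]. *)
Section Convex.
Context {R : realType} {n : nat}.
Implicit Types (h : 'cV[R]_n -> \bar R) (x y z : 'cV[R]_n).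
Local Open Scope ereal_scope.

Definition dom h : set 'cV[R]_n := [set x | h x < +oo].

Definition proper_fun h := (forall x, -oo < h x) /\ dom h !=set0.

Definition convex h := forall x y (t : R), (0 < t < 1)%R ->
  h (t *: x + (1 - t) *: y)%R <= t%:E * h x + (1 - t)%:E * h y.

Definition proper_closed_convex h :=
  [/\ proper_fun h, lower_semicontinuous h & convex h].

Definition strongly_convex (mu : R) h :=
  convex (fun x => h x - (mu / 2 * enorm x ^+ 2)%:E).

Definition lipschitz_on_dom (M : R) h := forall x y, dom h x -> dom h y ->
  `|h x - h y| <= (M * enorm (x - y)%R)%:E.

Definition conjugate h y : \bar R :=
  ereal_sup [set (dot x y)%:E - h x | x in [set: 'cV[R]_n]].

Definition argmin h : set 'cV[R]_n := [set z | forall x, h z <= h x].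

(* [prox h x z] says that z is the proximal point of h at x; it is unique
   when h is proper, closed and convex. *)
Definition prox h x : set 'cV[R]_n :=
  argmin (fun z => h z + (2^-1 * enorm (z - x)%R ^+ 2)%:E).

End Convex.

Section Problem.
Context {R : realType} {p n : nat}.
Variables (f : 'cV[R]_p -> \bar R) (g : 'cV[R]_n -> \bar R) (K : 'M[R]_(n, p)).
Local Open Scope ereal_scope.

Definition primal_obj (x : 'cV[R]_p) : \bar R := f x + g (K *m x)%R.

Definition primal_value : \bar R := ereal_inf [set primal_obj x | x in [set: 'cV[R]_p]].

Definition dual_obj (y : 'cV[R]_n) : \bar R :=
  conjugate f (- (K^T *m y))%R + conjugate g y.

Definition lagrangian (x : 'cV[R]_p) (y : 'cV[R]_n) : \bar R :=
  f x + (dot (K *m x) y)%:E - conjugate g y.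

End Problem.

Section Algorithm.
Context {R : realType} {p n : nat}.
Variables (f : 'cV[R]_p -> \bar R) (g : 'cV[R]_n -> \bar R) (K : 'M[R]_(n, p)).
Variables (gamma rho0 : R) (tau : nat -> R).

Definition relax : R := 2 - gamma^-1.

Definition rho_seq k : R := rho0 / tau k ^+ 2.
Definition beta_seq k : R := relax / (rho_seq k * opnorm K ^+ 2).
Definition eta_seq k : R := (1 - gamma) * rho_seq k.

(* The sequences x, xh, xt, y, yt, yb are x^k, \hat x^k, \tilde x^k, y^k,
   \tilde y^k, \bar y^k. An index k - 1 is rendered as k.-1; at k = 0 such terms
   are multiplied by 1 - tau 0, which is 0 for an admissible tau. *)
Record primal_dual_iterates (x0 : 'cV[R]_p) (y0 : 'cV[R]_n)
    (x xh xt : nat -> 'cV[R]_p) (y yt yb : nat -> 'cV[R]_n) : Prop := {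
  init_x : [/\ x 0%N = x0, xh 0%N = x0 & xt 0%N = x0];
  init_y : [/\ y 0%N = y0, yt 0%N = y0 & yb 0%N = y0];
  step_y k :
    prox (fun v => (rho_seq k)%:E * conjugate g v)%E
      (yt k + rho_seq k *: (K *m xh k)) (y k.+1);
  step_xt k :
    prox (fun u => (beta_seq k / tau k)%:E * f u)%E
      (xt k - (beta_seq k / tau k) *: (K^T *m y k.+1)) (xt k.+1);
  step_x k :
    prox (fun u => ((rho_seq k * opnorm K ^+ 2)^-1)%:E * f u)%E
      (xh k - (rho_seq k * opnorm K ^+ 2)^-1 *: (K^T *m y k.+1)) (x k.+1);
  step_xh k :
    xh k.+1 = (1 - tau k.+1) *: x k.+1 + tau k.+1 *: xt k.+1;
  step_yt k :
    yt k.+1 = yt k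
      + eta_seq k *: (K *m (x k.+1 - xh k - (1 - tau k) *: (x k - xh k.-1)))
      + (1 - gamma) *: (y k.+1 - yt k
          - (tau k.-1 ^+ 2 * (1 - tau k) / tau k ^+ 2) *: (y k - yt k.-1));
  step_yb k :
    yb k.+1 = (1 - tau k) *: yb k + tau k *: y k.+1 }.

End Algorithm.

(* Main.v *)
Require Import Defs.
From HB Require Import structures.
From mathcomp Require Import all_boot all_order all_algebra.
From mathcomp Require Import all_classical all_reals all_analysis.
From mathcomp Require Import ring lra.

Set Implicit Arguments.
Unset Strict Implicit.
Unset Printing Implicit Defensive.

Import Order.TTheory GRing.Theory Num.Theory.
Import numFieldTopology.Exports.

Local Open Scope classical_set_scope.
Local Open Scope ring_scope.

(** Why the theorem holds.

Strong duality. The qualification condition yields a Lagrange multiplier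
([lagrange_multiplier]), so that the dual optimal value is minus the primal one
and the Lagrangian at a dual solution never falls below the primal value on the
domain of f ([dual_solution_saddle]): this is the lower bound. The multiplier is
a subgradient of a convex value function, and it comes from a finite-dimensional
Hahn-Banach argument ([convex_linear_minorant]).

One step. The algorithm is a relaxed, accelerated augmented Lagrangian method
for minimising f x + g r subject to K x = r. Its iterate r, which the algorithm
does not form, is recovered from the proximal step in y ([split_iterate]).
Write l_k for the gap of the Lagrangian of the split problem at the dual
solution ([split_gap]) and A_k for K x^k - r^k ([infeasibility]). The proximal
inequalities of the three subproblems add up to an estimate of l_(k+1) by
(1 - tau_k) l_k, up to telescoping terms in the squared distances to the
primal and dual solutions and in the squared norm of A_k ([split_gap_step]).

Rate. With tau_k = c / (k + c), dividing by tau_k ^ 2 turns this estimate into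
the decrease of a potential whose main terms are (k + c - 1)^2 l_k and a multiple
of (k + c - 1)^4 |A_k|^2. The growth of the weight of the squared distance to the
primal solution is paid for by the strong convexity of f; the bound on rho0 says
exactly this. The potential bounds l_k and |A_k| ([gap_bound]). As c > 2, some
decrease is left over, and summing it shows that the series of
k l_k + b k^3 |A_k|^2 converges for a constant b ([gap_summable]). The series of
1 / (k ln k) diverges, so k ln k times this general term has inferior limit 0
([bounded_series_liminf]). Both claims on the Lagrangian follow, since its gap
lies between 0 and l_k ([split_gap_ge]).

Lipschitz g. A subgradient of g at K x^k of norm at most Mg bounds the primal
gap by l_k + (|y*| + Mg) |A_k| ([primal_gap_le]). *)

(** * The Euclidean inner product *)

Section InnerProduct.
Context {R : realType}.

Section Dot.
Context {n : nat}.
Implicit Types (u v w : 'cV[R]_n) (a : R).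

Lemma dotC u v : dot u v = dot v u.
Proof. by apply: eq_bigr => i _; rewrite mulrC. Qed.

Lemma dotDl u v w : dot (u + v) w = dot u w + dot v w.
Proof. by rewrite -big_split; apply: eq_bigr => i _; rewrite !mxE mulrDl. Qed.

Lemma dotDr u v w : dot u (v + w) = dot u v + dot u w.
Proof. by rewrite dotC dotDl ![dot _ u]dotC. Qed.

Lemma dotZl a u v : dot (a *: u) v = a * dot u v.
Proof. by rewrite mulr_sumr; apply: eq_bigr => i _; rewrite mxE mulrA. Qed.

Lemma dotZr a u v : dot u (a *: v) = a * dot u v.
Proof. by rewrite dotC dotZl dotC. Qed.

Lemma dotNl u v : dot (- u) v = - dot u v.
Proof. by rewrite -scaleN1r dotZl mulN1r. Qed.

Lemma dotNr u v : dot u (- v) = - dot u v.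
Proof. by rewrite dotC dotNl dotC. Qed.

Lemma dot0l u : dot 0 u = 0.
Proof. by rewrite -(scale0r u) dotZl mul0r. Qed.

Definition dotE := (dotDl, dotDr, dotNl, dotNr, dotZl, dotZr).

Lemma dot_ge0 u : 0 <= dot u u.
Proof. by apply: sumr_ge0 => i _; rewrite -expr2 sqr_ge0. Qed.

Lemma dot_eq0 u : dot u u = 0 -> u = 0.
Proof.
move=> /eqP; rewrite psumr_eq0 => [/allP u0|i _]; last by rewrite -expr2 sqr_ge0.
apply/matrixP => i j; rewrite ord1 mxE.
by have /eqP := u0 i (mem_index_enum i); rewrite -expr2 => /eqP; rewrite sqrf_eq0 => /eqP.
Qed.

Lemma enorm_sqr u : enorm u ^+ 2 = dot u u.
Proof. by rewrite sqr_sqrtr ?dot_ge0. Qed.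

Lemma enorm_ge0 u : 0 <= enorm u.
Proof. exact: sqrtr_ge0. Qed.

Lemma enorm_eq0 u : enorm u = 0 -> u = 0.
Proof. by move=> u0; apply: dot_eq0; rewrite -enorm_sqr u0 expr0n. Qed.

Lemma enormZ a u : enorm (a *: u) = `|a| * enorm u.
Proof. by rewrite /enorm dotZl dotZr mulrA -expr2 sqrtrM ?sqr_ge0 ?sqrtr_sqr. Qed.

Lemma enormN u : enorm (- u) = enorm u.
Proof. by rewrite /enorm dotNl dotNr opprK. Qed.

Lemma enorm0 : enorm (0 : 'cV[R]_n) = 0.
Proof. by rewrite /enorm dot0l sqrtr0. Qed.

Lemma dot_le_enorm u v : dot u v <= enorm u * enorm v.
Proof.
have [/enorm_eq0 ->|u0] := eqVneq (enorm u) 0; first by rewrite dot0l enorm0 mul0r.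
have [/enorm_eq0 ->|v0] := eqVneq (enorm v) 0.
  by rewrite dotC dot0l enorm0 mulr0.
have uv : 0 < enorm u * enorm v by rewrite mulr_gt0 // lt0r enorm_ge0 ?u0 ?v0.
have := dot_ge0 (enorm v *: u - enorm u *: v).
rewrite !dotE (dotC v u) -!enorm_sqr => h.
rewrite -subr_ge0 -(pmulr_rge0 _ uv); lra.
Qed.

Lemma enormD u v : enorm (u + v) <= enorm u + enorm v.
Proof.
rewrite -[leRHS]ger0_norm ?addr_ge0 ?enorm_ge0 // -sqrtr_sqr ler_wsqrtr //.
have := dot_le_enorm u v.
rewrite sqrrD !enorm_sqr !dotE (dotC v u); lra.
Qed.

End Dot.

Lemma dot_trmx {m n} (A : 'M[R]_(m, n)) u v : dot (A^T *m v) u = dot v (A *m u).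
Proof.
rewrite /dot; under eq_bigr do rewrite mxE mulr_suml.
rewrite exchange_big /=; apply: eq_bigr => i _.
by rewrite mxE mulr_sumr; apply: eq_bigr => j _; rewrite mxE; ring.
Qed.

Lemma opnorm_bounded {m n} (A : 'M[R]_(m, n)) : has_ubound
  [set enorm (A *m x) | x in [set x : 'cV[R]_n | enorm x <= 1]].
Proof.
exists (Num.sqrt (\sum_i enorm (row i A)^T ^+ 2)) => _ [x /= x1 <-].
rewrite ler_wsqrtr //; apply: ler_sum => i _.
have -> : (A *m x) i 0 = dot (row i A)^T x.
  by rewrite mxE; apply: eq_bigr => j _; rewrite !mxE.
rewrite -expr2 -ler_sqrt ?sqr_ge0 // !sqrtr_sqr (ger0_norm (enorm_ge0 _)).
have le1 z : dot (row i A)^T z <= enorm (row i A)^T * enorm z.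
  exact: dot_le_enorm.
rewrite ler_norml -lerNl -dotNr !(le_trans (le1 _)) ?enormN //.
  by rewrite ler_piMr ?enorm_ge0.
by rewrite ler_piMr ?enorm_ge0.
Qed.

Lemma opnorm_ge0 {m n} (A : 'M[R]_(m, n)) : 0 <= opnorm A.
Proof.
apply: ub_le_sup; first exact: opnorm_bounded.
by exists 0; rewrite /= ?mulmx0 enorm0.
Qed.

Lemma enorm_mulmx {m n} (A : 'M[R]_(m, n)) u :
  enorm (A *m u) <= opnorm A * enorm u.
Proof.
have [/enorm_eq0 ->|u0] := eqVneq (enorm u) 0.
  by rewrite mulmx0 !enorm0 mulr0.
have {}u0 : 0 < enorm u by rewrite lt0r u0 enorm_ge0.
rewrite -ler_pdivrMr //; apply: ub_le_sup; first exact: opnorm_bounded.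
exists ((enorm u)^-1 *: u) => /=.
  by rewrite enormZ ger0_norm ?invr_ge0 ?enorm_ge0 // mulVf // gt_eqF.
by rewrite -scalemxAr enormZ ger0_norm ?invr_ge0 ?enorm_ge0 // mulrC.
Qed.

End InnerProduct.

(** * Linear minorants of convex sets *)

(** Finite-dimensional Hahn-Banach, with C in the role of the epigraph of a
convex function that is nonnegative at the origin; the second hypothesis says
in algebraic terms that the origin is in the relative interior of its domain.
The linear form is built one coordinate at a time. When the coordinate k is
added, its coefficient a has to satisfy dot w y + w_k a <= s for every (w, s)
in C supported on the coordinates up to k: an upper bound for a if w_k > 0, a lower bound if
w_k < 0. Each lower bound is at most each upper bound, because the convex
combination of the two points that cancels the coordinate k is already under
control. The second hypothesis provides bounds of both kinds as soon as there
is one of either kind. *)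
Lemma convex_linear_minorant {R : realType} {n : nat} (C : 'cV[R]_n -> R -> Prop) :
  (forall w1 s1 w2 s2 t, C w1 s1 -> C w2 s2 -> 0 < t < 1 ->
     C (t *: w1 + (1 - t) *: w2) (t * s1 + (1 - t) * s2)) ->
  (forall w s, C w s -> exists t s', 0 < t /\ C (- t *: w) s') ->
  (forall s, C 0 s -> 0 <= s) ->
  exists y, forall w s, C w s -> dot w y <= s.
Proof.
move=> Cconv Copp C0.
pose supp k (w : 'cV[R]_n) := forall i : 'I_n, (k <= i)%N -> w i 0 = 0.
suff /(_ n (leqnn n)) [y hy] : forall k, (k <= n)%N ->
    exists y, forall w s, C w s -> supp k w -> dot w y <= s.
  exists y => w s Cws; apply: hy => // i.
  by rewrite leqNgt ltn_ord.
elim=> [_|k IHk kn].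
  exists 0 => w s Cws w0.
  have {}w0 : w = 0 by apply/matrixP => i j; rewrite ord1 mxE w0.
  by rewrite w0 dot0l C0 // -w0.
have [y hy] := IHk (ltnW kn); pose e : 'I_n := Ordinal kn.
have suppS w : supp k.+1 w -> w e 0 = 0 -> supp k w.
  move=> wk we i; rewrite leq_eqVlt => /orP[/eqP ki|]; last exact: wk.
  by rewrite -we; congr (w _ 0); apply: val_inj.
have [[w0 [s0 [Cw0 kw0 w0e]]]|no] := pselect (exists w s,
    [/\ C w s, supp k.+1 w & w e 0 != 0]); last first.
  exists y => w s Cws kw; apply: hy => //; apply: suppS => //.
  by apply: contra_notP no => /eqP we; exists w, s.
pose B := [set q | exists w s, [/\ C w s, supp k.+1 w, 0 < w e 0 &
                    q = (s - dot w y) / w e 0]].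
pose A := [set q | exists w s, [/\ C w s, supp k.+1 w, w e 0 < 0 &
                    q = (s - dot w y) / w e 0]].
have AB q q' : A q -> B q' -> q <= q'.
  move=> [w2 [s2 [Cw2 kw2 w2e ->]]] [w1 [s1 [Cw1 kw1 w1e ->]]].
  set a := w2 e 0 in w2e *; set b := w1 e 0 in w1e *.
  have ba : 0 < b - a by lra.
  (* the weight that cancels the coordinate k of the combination *)
  pose t := - a / (b - a).
  have t01 : 0 < t < 1.
    by rewrite divr_gt0 ?oppr_gt0 //= ltr_pdivrMr // mul1r; lra.
  have t1 : 1 - t = b / (b - a) by rewrite /t; field; lra.
  have := hy _ _ (Cconv _ _ _ _ _ Cw1 Cw2 t01).
  move=> /(_ _)/wrap[].
    apply: suppS => [i ki|]; first by rewrite !mxE kw1 // kw2 // !mulr0 addr0.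
    by rewrite !mxE -/a -/b t1 /t; field; lra.
  rewrite !dotE t1 /t -!mulrA ![(b - a)^-1 * _]mulrC !mulrA -!mulrDl.
  rewrite ler_pM2r ?invr_gt0 // => h.
  rewrite -subr_ge0; have -> : (s1 - dot w1 y) / b - (s2 - dot w2 y) / a =
    ((- a * s1 + b * s2) - (- a * dot w1 y + b * dot w2 y)) / (b * - a).
    by field; lra.
  by rewrite divr_ge0 ?subr_ge0 // mulr_ge0; lra.
have ABne : A !=set0 /\ B !=set0.
  have [t [s1 [t0 Cw1]]] := Copp _ _ Cw0.
  have kw1 : supp k.+1 (- t *: w0) by move=> i ki; rewrite !mxE kw0 // mulr0.
  have we1 : (- t *: w0) e 0 = - t * w0 e 0 by rewrite mxE.
  case: (ltrgtP (w0 e 0) 0) w0e => // w0e _; split.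
  - by exists ((s0 - dot w0 y) / w0 e 0), w0, s0.
  - exists ((s1 - dot (- t *: w0) y) / (- t *: w0) e 0), (- t *: w0), s1; split => //.
    by rewrite we1; nra.
  - exists ((s1 - dot (- t *: w0) y) / (- t *: w0) e 0), (- t *: w0), s1; split => //.
    by rewrite we1; nra.
  - by exists ((s0 - dot w0 y) / w0 e 0), w0, s0.
exists (y + inf B *: delta_mx e 0) => w s Cws kw.
have -> : dot w (y + inf B *: delta_mx e 0) = dot w y + w e 0 * inf B.
  rewrite !dotE mulrC; congr (_ + _ * _).
  rewrite /dot (bigD1 e) //= big1 ?addr0 ?mxE ?eqxx ?mulr1 // => i ie.
  by rewrite mxE (negbTE ie) mulr0.
have [we|we|we] := ltrgtP (w e 0) 0.
- have : (s - dot w y) / w e 0 <= inf B.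
    by apply: lb_le_inf ABne.2 _ => q; apply: AB; exists w, s.
  rewrite ler_ndivrMr //; lra.
- have : inf B <= (s - dot w y) / w e 0.
    apply: ge_inf; last by exists w, s.
    by have [q Aq] := ABne.1; exists q => q' /(AB _ _ Aq).
  rewrite ler_pdivlMr //; lra.
- by rewrite we mul0r addr0; apply: hy => //; apply: suppS.
Qed.

(** * Convex functions and proximal points *)

Section ConvexFunctions.
Context {R : realType} {n : nat}.
Implicit Types (h : 'cV[R]_n -> \bar R).

Lemma dom_fine h x : (forall x, -oo < h x)%E -> dom h x -> (fine (h x))%:E = h x.
Proof. by move=> hNy hx; rewrite fineK // fin_real // hNy. Qed.

Lemma notin_dom h x : ~ dom h x -> h x = +oo%E.
Proof. by move=> /negP; rewrite -leNgt leye_eq => /eqP. Qed.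

(** Strong convexity in its usual form. The quadratic term is what remains of
the identity relating the squared norms of u, z and their combination. *)
Lemma strongly_convex_fine h mu u z t : (forall x, -oo < h x)%E ->
  strongly_convex mu h -> dom h u -> dom h z -> 0 < t < 1 ->
  dom h (t *: u + (1 - t) *: z) /\
  fine (h (t *: u + (1 - t) *: z)) <= t * fine (h u) + (1 - t) * fine (h z)
    - mu / 2 * (t * (1 - t)) * dot (u - z) (u - z).
Proof.
move=> hNy hconv hu hz t01; have := hconv u z t t01.
rewrite -(dom_fine hNy hu) -(dom_fine hNy hz) /= !enorm_sqr.
have := hNy (t *: u + (1 - t) *: z); rewrite /dom /=.
case: (h _) => [r| |] // _; rewrite ltry lee_fin !dotE (dotC z u) /= => le.
by split=> //; lra.
Qed.

Lemma strongly_convex0 h : convex h -> strongly_convex 0 h.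
Proof.
move=> hconv x y t t01; rewrite /= mul0r !mul0r !sube0; exact: hconv.
Qed.

Lemma fenchel_young h x y : ((dot x y)%:E - h x <= conjugate h y)%E.
Proof. by apply: ereal_sup_ubound; exists x. Qed.

Lemma conjugate_gtNy h y : proper_fun h -> (-oo < conjugate h y)%E.
Proof.
move=> [hNy [x hx]]; apply: lt_le_trans (fenchel_young h x y).
by rewrite -(dom_fine hNy hx) -EFinB ltNyr.
Qed.

Lemma conjugate_convex h : proper_fun h -> convex (conjugate h).
Proof.
move=> hprop x y t t01; apply: ge_ereal_sup => _ [z _ <-].
have := fenchel_young h z x; have := fenchel_young h z y.
have := conjugate_gtNy x hprop; have := conjugate_gtNy y hprop.
have [t0 t1] : 0 < t /\ 0 < 1 - t by lra.
have := hprop.1 z; case: (h z) => [r| |] //= _.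
case: (conjugate h y) => [b| |] // _; case: (conjugate h x) => [a| |] // _.
- rewrite !lee_fin !dotE /= => hb ha; nra.
- by move=> _ _; rewrite gt0_muley ?lte_fin // -EFinM addye // leey.
- by move=> _ _; rewrite gt0_muley ?lte_fin // -EFinM addey // leey.
- by move=> _ _; rewrite !gt0_muley ?lte_fin // leey.
- by move=> *; rewrite addeNy leNye.
Qed.

Lemma ge0_small_slope (A B : R) : (forall t, 0 < t < 1 -> 0 <= A + t * B) -> 0 <= A.
Proof.
move=> AB; rewrite leNgt; apply/negP => A0.
have [B0|B0] := leP B 0; first by have := AB 2^-1 ltac:(lra); lra.
have BA : 0 < 2 * B - A by lra.
have := AB (- A / (2 * B - A)).
rewrite divr_gt0 ?oppr_gt0 // ltr_pdivrMr // mul1r.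
have -> : A + - A / (2 * B - A) * B = A * (B - A) / (2 * B - A) by field; lra.
rewrite pmulr_lge0 ?invr_gt0 // => /(_ ltac:(lra)); nra.
Qed.

(** First-order optimality, obtained without subdifferential calculus: compare
the minimiser z with the points t u + (1 - t) z and let t tend to 0. *)
Lemma prox_variational h mu lam a z : (forall x, -oo < h x)%E -> dom h !=set0 ->
  strongly_convex mu h -> 0 < lam -> prox (fun u => lam%:E * h u)%E a z ->
  dom h z /\ forall u, dom h u ->
    fine (h z) + dot (lam^-1 *: (a - z)) (u - z) + mu / 2 * dot (u - z) (u - z)
      <= fine (h u).
Proof.
move=> hNy [u0 hu0] hconv lam0 hprox.
have hz : dom h z.
  have := hprox u0; rewrite -(dom_fine hNy hu0) /dom /=; have := hNy z.
  by case: (h z) => [r| |] // _; rewrite ?ltry // gt0_muley ?lte_fin.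
split=> // u hu; set q := dot (u - z) (u - z).
suff : 0 <= lam * (fine (h u) - fine (h z) - mu / 2 * q) - dot (a - z) (u - z).
  rewrite dotZl => le; rewrite -subr_ge0 -(pmulr_rge0 _ lam0).
  have : lam * (lam^-1 * dot (a - z) (u - z)) = dot (a - z) (u - z).
    by rewrite mulrA mulfV ?mul1r ?gt_eqF.
  rewrite -/q; lra.
apply: (@ge0_small_slope _ (lam * (mu / 2 * q) + q / 2)) => t t01.
have [ht le] := strongly_convex_fine hNy hconv hu hz t01.
have hp := hprox (t *: u + (1 - t) *: z); move: hp => /=.
rewrite -(dom_fine hNy hz) -(dom_fine hNy ht) -!EFinM -!EFinD lee_fin !enorm_sqr.
have -> : t *: u + (1 - t) *: z - a = t *: (u - z) - (a - z).
  by apply/matrixP => i j; rewrite !mxE; ring.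
have -> : z - a = - (a - z) by rewrite opprB.
move: le; rewrite /q /=; move: (a - z) (u - z) => b e.
rewrite !dotE (dotC e b) => /(ler_wpM2l (ltW lam0)) le hp.
have t0 : 0 < t by lra.
rewrite -(pmulr_rge0 _ t0); lra.
Qed.

End ConvexFunctions.

(** * Lagrange multipliers and subgradients *)

Section Duality.
Context {R : realType}.

(** The points - t w lie in the affine hull, being affine combinations of w and
of the points that represent 0, and they tend to 0 with t. *)
Lemma relint0_opposite {n} (A : set 'cV[R]_n) w : relint A 0 -> A w ->
  exists2 t, 0 < t & A (- t *: w).
Proof.
move=> [[m [a [l [Aa l1 l0]]]]]; rewrite /within /= => /nbhs_normP[e /= e0 eA] Aw.
have w1 : 0 < `|w| + 1 by rewrite ltr_wpDl.
exists (e / (`|w| + 1)); first by rewrite divr_gt0.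
set t := _ / _; have t0 : 0 < t by rewrite divr_gt0.
apply: eA.
  rewrite /= sub0r normrN normrZ normrN gtr0_norm // /t mulrAC.
  by rewrite ltr_pdivrMr // ltr_pM2l // ltrDl.
exists m.+1, (fun i => oapp a w (unlift ord0 i)),
  (fun i => oapp (fun j => (1 + t) * l j) (- t) (unlift ord0 i)); split.
- by move=> i; case: unliftP => [j|] _ /=.
- rewrite big_ord_recl unlift_none /=; under eq_bigr do rewrite liftK /=.
  by rewrite -mulr_sumr l1; ring.
- rewrite big_ord_recl unlift_none /=; under eq_bigr do rewrite liftK /= -scalerA.
  by rewrite -scaler_sumr -l0 scaler0 addr0.
Qed.

Lemma relint_subset {n} (A : set 'cV[R]_n) z : relint A z -> A z.
Proof. by move=> [Hz /nbhs_singleton]; exact. Qed.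

(** The value function w |-> inf { f u + g v | v - K u = w } is convex and the
qualification condition puts 0 in the relative interior of its domain, so it
has a subgradient there: a Lagrange multiplier. *)
Lemma lagrange_multiplier {p n} (f : 'cV[R]_p -> \bar R) (g : 'cV[R]_n -> \bar R)
    (K : 'M[R]_(n, p)) (s : R) :
  (forall x, -oo < f x)%E -> (forall x, -oo < g x)%E -> convex f -> convex g ->
  relint [set v - K *m u | v in dom g & u in dom f] 0 ->
  (forall u, s%:E <= primal_obj f g K u)%E ->
  exists y, forall u v, dom f u -> dom g v ->
    s + dot (v - K *m u) y <= fine (f u) + fine (g v).
Proof.
move=> fNy gNy /strongly_convex0 fconv /strongly_convex0 gconv ri sle.
pose C (w : 'cV[R]_n) (r : R) := exists u v, [/\ dom f u, dom g v,
  w = v - K *m u & fine (f u) + fine (g v) - s <= r].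
have [||r [u [v [fu gv /esym/eqP]]]|y hy] := @convex_linear_minorant R n C.
- move=> w1 r1 w2 r2 t [u1 [v1 [fu1 gv1 -> le1]]] [u2 [v2 [fu2 gv2 -> le2]]] t01.
  have [fu fle] := strongly_convex_fine fNy fconv fu1 fu2 t01.
  have [gv gle] := strongly_convex_fine gNy gconv gv1 gv2 t01.
  exists (t *: u1 + (1 - t) *: u2), (t *: v1 + (1 - t) *: v2); split => //.
    rewrite mulmxDr -!scalemxAr; move: (K *m u1) (K *m u2) => k1 k2.
    by apply/matrixP => i j; rewrite !mxE; ring.
  have [t0 t1] : 0 < t /\ 0 < 1 - t by lra.
  have := ler_wpM2l (ltW t0) le1; have := ler_wpM2l (ltW t1) le2; lra.
- move=> w r [u [v [fu gv wE _]]].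
  have [|t t0 [v' gv' [u' fu' wE']]] := relint0_opposite (w := w) ri.
    by exists v => //; exists u.
  exists t, (fine (f u') + fine (g v') - s); split=> //.
  by exists u', v'.
- rewrite subr_eq0 => /eqP vE le; have := sle u; rewrite /primal_obj -vE.
  rewrite -(dom_fine fNy fu) -(dom_fine gNy gv) -EFinD lee_fin; lra.
exists y => u v fu gv; rewrite -lerBrDl; apply: hy; exists u, v; split=> //.
Qed.

(** The infimal convolution of z |-> g z - g w with M times the norm is finite
everywhere, vanishes at w and is at most M times the distance to w. A linear form
below it is therefore a subgradient of g at w of norm at most M, even when w
lies on the boundary of the domain. *)
Lemma lipschitz_subgradient {n} (g : 'cV[R]_n -> \bar R) M w :
  (forall x, -oo < g x)%E -> convex g -> 0 <= M -> lipschitz_on_dom M g ->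
  dom g w -> exists2 y, enorm y <= M &
    forall z, dom g z -> fine (g w) + dot (z - w) y <= fine (g z).
Proof.
move=> gNy /strongly_convex0 gconv M0 glip gw.
pose C (d : 'cV[R]_n) (r : R) := exists2 z, dom g z &
  fine (g z) - fine (g w) + M * enorm (d - (z - w)) <= r.
have [|d r _|r [z gz]|y hy] := @convex_linear_minorant R n C.
- move=> d1 r1 d2 r2 t [z1 gz1 le1] [z2 gz2 le2] t01.
  have [gz gle] := strongly_convex_fine gNy gconv gz1 gz2 t01.
  exists (t *: z1 + (1 - t) *: z2) => //.
  have [t0 t1] : 0 < t /\ 0 < 1 - t by lra.
  have -> : t *: d1 + (1 - t) *: d2 - (t *: z1 + (1 - t) *: z2 - w) =
      t *: (d1 - (z1 - w)) + (1 - t) *: (d2 - (z2 - w)).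
    by apply/matrixP => i j; rewrite !mxE; ring.
  have := ler_wpM2l M0 (enormD (t *: (d1 - (z1 - w))) ((1 - t) *: (d2 - (z2 - w)))).
  rewrite !enormZ !gtr0_norm //.
  have := ler_wpM2l (ltW t0) le1; have := ler_wpM2l (ltW t1) le2; lra.
- exists 1, (M * enorm (- 1 *: d)); split=> //; exists w => //.
  by rewrite !subrr subr0 add0r.
- move=> le; have := glip z w gz gw; rewrite sub0r enormN in le.
  rewrite -(dom_fine gNy gz) -(dom_fine gNy gw) -EFinB lee_fin ler_norml; lra.
exists y => [|z gz]; last first.
  have : C (z - w) (fine (g z) - fine (g w)).
    by exists z => //; rewrite subrr enorm0 mulr0 addr0.
  by move/hy; lra.
have : C y (M * enorm y) by exists w => //; rewrite !subrr subr0 add0r.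
move/hy; rewrite -enorm_sqr => le.
have [-> //|y0] := eqVneq (enorm y) 0.
have {}y0 : 0 < enorm y by rewrite lt0r y0 enorm_ge0.
by rewrite -(ler_pM2r y0) -expr2.
Qed.

End Duality.

(** * Strong duality *)

Section DualSolution.
Context {R : realType} {p n : nat}.
Variables (f : 'cV[R]_p -> \bar R) (g : 'cV[R]_n -> \bar R) (K : 'M[R]_(n, p)).

Lemma conjugate_at_multiplier (s : R) y : proper_fun f -> proper_fun g ->
  (forall u v, dom f u -> dom g v ->
    s + dot (v - K *m u) y <= fine (f u) + fine (g v)) ->
  (dual_obj f g K y <= (- s)%:E)%E.
Proof.
move=> fprop gprop hy.
have gle u : dom f u -> (conjugate g y <= (fine (f u) - s + dot (K *m u) y)%:E)%E.
  move=> fu; apply: ge_ereal_sup => _ [v _ <-].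
  have [gv|] := pselect (dom g v); last first.
    by move=> /notin_dom ->; rewrite addeNy leNye.
  rewrite -(dom_fine gprop.1 gv) -EFinB lee_fin.
  have := hy u v fu gv; rewrite !dotE; lra.
have [u0 fu0] := fprop.2.
rewrite /dual_obj; have := conjugate_gtNy y gprop; have := gle u0 fu0.
case gy : (conjugate g y) => [b| |] // _ _.
rewrite -leeBrDr // -EFinB; apply: ge_ereal_sup => _ [u _ <-].
have [fu|] := pselect (dom f u); last first.
  by move=> /notin_dom ->; rewrite addeNy leNye.
have := gle u fu; rewrite gy lee_fin -(dom_fine fprop.1 fu) -EFinB lee_fin.
by rewrite dotNr (dotC u) dot_trmx (dotC y); lra.
Qed.

(** Strong duality: a dual solution does at least as well as a multiplier, and
Fenchel's inequality for f turns the dual value into a saddle inequality. *)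
Lemma dual_solution_saddle (s : R) ystar :
  proper_closed_convex f -> proper_closed_convex g ->
  relint [set v - K *m u | v in dom g & u in dom f] 0 ->
  (forall u, s%:E <= primal_obj f g K u)%E -> argmin (dual_obj f g K) ystar ->
  dom (conjugate g) ystar /\ forall u, dom f u ->
    s <= fine (f u) + dot (K *m u) ystar - fine (conjugate g ystar).
Proof.
move=> [fprop _ fconv] [gprop _ gconv] ri sle ymin.
have [y hy] := lagrange_multiplier fprop.1 gprop.1 fconv gconv ri sle.
have := le_trans (ymin y) (conjugate_at_multiplier fprop gprop hy).
rewrite /dual_obj /dom /=.
have := conjugate_gtNy (- (K^T *m ystar)) fprop; have := conjugate_gtNy ystar gprop.
case: (conjugate g ystar) => [b| |] //; last by case: (conjugate f _).
case fE : (conjugate f _) => [a| |] // _ _; rewrite -EFinD lee_fin => le.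
split=> [|u fu]; first by rewrite ltry.
have := fenchel_young f u (- (K^T *m ystar)).
rewrite fE -(dom_fine fprop.1 fu) -EFinB lee_fin dotNr (dotC u) dot_trmx (dotC ystar) /=.
lra.
Qed.

End DualSolution.

(** * Quadratic estimates for one step *)

Section OneStep.
Context {R : realType}.

(** This is where the value Gamma = 2 - 1 / gamma comes from. Multiplied by
Gamma, the left-hand side is minus the squared norm of (1 - Gamma) d + w: with
a larger Gamma the quadratic form would be indefinite. *)
Lemma relaxation_absorbs_displacement {n} (gamma : R) (d w : 'cV[R]_n) :
  2^-1 < gamma < 1 ->
  (gamma^-1 - 1) * dot d d - dot w w + (1 - (relax gamma)^-1) * dot (d + w) (d + w) <= 0.
Proof.
move=> /andP[g1 g2]; have g0 : 0 < gamma by lra.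
have Gam0 : 0 < relax gamma.
  rewrite /relax subr_gt0 invf_plt ?posrE //; lra.
have -> : gamma^-1 = 2 - relax gamma by rewrite /relax; ring.
set G := relax gamma in Gam0 *.
rewrite -(pmulr_rle0 _ Gam0).
have := dot_ge0 ((1 - G) *: d + w).
rewrite !dotE (dotC w d) => h.
have -> : forall A B D, G * ((2 - G - 1) * A - D + (1 - G^-1) * B) =
    (2 - G - 1) * G * A - G * D - (1 - G) * B by move=> A B D; field; lra.
lra.
Qed.

(** The Nesterov-type estimate for the two proximal steps in x. The first
inequality is tested at the convex combination z of x and of the new anchor
xtp, where f is bounded by convexity; the second one is tested at the solution
xs. Since z - xh is tau times the anchor step, the quadratic terms combine into
a telescoping part and a form in d and w. *)
Lemma primal_step {p n} (K : 'M[R]_(n, p)) (phi : 'cV[R]_p -> R) (v : 'cV[R]_n)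
    (x xp xt xtp xs : 'cV[R]_p) (tau a Gam mu : R)
    (xh := (1 - tau) *: x + tau *: xt) (z := (1 - tau) *: x + tau *: xtp)
    (d := xp - xh) (w := z - xp) :
  0 <= tau ->
  phi xp + dot (a *: (xh - xp) - K^T *m v) (z - xp) <= phi z ->
  phi z <= (1 - tau) * phi x + tau * phi xtp ->
  phi xtp + dot ((tau * a / Gam) *: (xt - xtp) - K^T *m v) (xs - xtp)
    + mu / 2 * dot (xs - xtp) (xs - xtp) <= phi xs ->
  phi xp <= (1 - tau) * phi x + tau * phi xs
    - dot v (K *m xp - (1 - tau) *: (K *m x) - tau *: (K *m xs))
    + a / 2 * ((1 - Gam^-1) * dot (d + w) (d + w) - dot d d - dot w w)
    + tau ^+ 2 * a / 2 / Gam * (dot (xs - xt) (xs - xt) - dot (xs - xtp) (xs - xtp))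
    - tau * mu / 2 * dot (xs - xtp) (xs - xtp).
Proof.
move=> tau0 hx hz /(ler_wpM2l tau0) hxt.
have dw : d + w = tau *: (xtp - xt).
  by apply/matrixP => i j; rewrite /d /w /z /xh !mxE; ring.
have wz : z - xp = w by [].
have dx : xh - xp = - d by rewrite /d opprB.
have Kw : K *m w = (1 - tau) *: (K *m x) + tau *: (K *m xtp) - K *m xp.
  by rewrite mulmxBr mulmxDr -!scalemxAr.
move: hx hz hxt; rewrite !wz dx.
clearbody d w z xh.
rewrite !(dotDl (_ *: _) (- _)) !dotNl !dot_trmx Kw mulmxBr.
have e1 : dot (d + w) (d + w) = tau ^+ 2 * dot (xtp - xt) (xtp - xt).
  by rewrite dw dotZl dotZr; ring.
have : dot (d + w) (d + w) = dot d d + dot w w + 2 * dot d w.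
  by rewrite !dotE (dotC w d); ring.
rewrite e1 => {e1}.
have -> : xs - xt = (xs - xtp) + (xtp - xt) by rewrite subrKA.
have -> : xt - xtp = - (xtp - xt) by rewrite opprB.
move: (xs - xtp) (xtp - xt) => q e.
rewrite !dotE (dotC e q) => /(congr1 ( *%R (a / 2))) h1 h2 h3 h4; lra.
Qed.

(** The multiplier update ytp = yt + eta D makes the pairing with D telescope,
up to eta / 2 times the squared norm of D. The pairing of D with the
infeasibility Ap telescopes too, at the price of - rho / 2 times that squared
norm. As eta = (1 - gamma) rho, a fraction gamma of the latter is left, and it
absorbs the cross term with Kd by Young's inequality. *)
Lemma dual_step {n} (gamma rho tau : R) (As Ap Kd yt ytp ys : 'cV[R]_n)
    (eta := (1 - gamma) * rho) (D := Ap - (1 - tau) *: As)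
    (v := yt + rho *: (Ap - Kd)) :
  0 < gamma < 1 -> 0 < rho -> ytp = yt + eta *: D ->
  dot (ys - v) D <=
    (dot (ys - yt) (ys - yt) - dot (ys - ytp) (ys - ytp)) / (2 * eta)
    - rho / 2 * dot Ap Ap + rho / 2 * (1 - tau) ^+ 2 * dot As As
    + rho / 2 / gamma * dot Kd Kd.
Proof.
move=> /andP[g0 g1] r0 ->.
have eta0 : 0 < eta by rewrite mulr_gt0 //; lra.
have -> : ys - v = (ys - yt) - rho *: (Ap - Kd) by rewrite /v opprD addrA.
have hAs : (1 - tau) ^+ 2 * dot As As = dot (Ap - D) (Ap - D).
  by rewrite /D subKr dotZl dotZr; ring.
rewrite -(mulrA (rho / 2)) hAs; clearbody D => {hAs v}.
have -> : dot (ys - (yt + eta *: D)) (ys - (yt + eta *: D)) =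
    dot (ys - yt) (ys - yt) - 2 * eta * dot (ys - yt) D + eta ^+ 2 * dot D D.
  by rewrite opprD addrA; move: (ys - yt) => q; rewrite !dotE (dotC D q); ring.
have -> : forall q s t, (q - (q - 2 * eta * s + eta ^+ 2 * t)) / (2 * eta) = s - eta / 2 * t.
  by move=> q s t; field; rewrite gt_eqF.
rewrite -subr_ge0.
have := mulr_ge0 (ltW (divr_gt0 r0 g0)) (dot_ge0 (gamma *: D - Kd)).
have -> : rho / gamma * dot (gamma *: D - Kd) (gamma *: D - Kd) =
    rho * gamma * dot D D - 2 * rho * dot D Kd + rho / gamma * dot Kd Kd.
  by rewrite !dotE (dotC Kd D); field; rewrite gt_eqF.
rewrite !dotE (dotC D Ap) (dotC Kd D) /eta => h; lra.
Qed.

End OneStep.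

(** * The iterates of the algorithm *)

Lemma scaled_residual {R : realType} {n : nat} (a : R) (u w v : 'cV[R]_n) :
  a != 0 -> a^-1 *: (u - a *: w - v) = a^-1 *: (u - v) - w.
Proof.
by move=> a0; rewrite addrAC scalerBr scalerA mulVf // scale1r.
Qed.

Section Iterates.
Context {R : realType} {p n : nat}.
Variables (f : 'cV[R]_p -> \bar R) (g : 'cV[R]_n -> \bar R) (K : 'M[R]_(n, p)).
Variables (gamma rho0 : R) (tau : nat -> R) (x0 : 'cV[R]_p) (y0 : 'cV[R]_n)
  (x xh xt : nat -> 'cV[R]_p) (y yt yb : nat -> 'cV[R]_n)
  (ystar : 'cV[R]_n) (s : R).

Let rho := rho_seq rho0 tau.

(** By Moreau's identity, the proximal step in y is a multiplier step of an
augmented Lagrangian method for minimising f x + g r subject to K x = r, and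
this is its iterate r: a subgradient of the conjugate of g at y k. *)
Definition split_iterate k := K *m xh k.-1 - (rho k.-1)^-1 *: (y k - yt k.-1).

Definition infeasibility k := K *m x k - split_iterate k.

(** The Lagrangian of the split problem at (x, r, ystar), minus s, with g r
replaced by dot y r minus the conjugate at y, that is, by the biconjugate of g
at r. The estimates use only that the biconjugate is attained at y k and lies
below g, which is Fenchel's inequality. *)
Definition split_gap k :=
  fine (f (x k)) + (dot (y k) (split_iterate k) - fine (conjugate g (y k)))
  + dot (infeasibility k) ystar - s.

Hypothesis it : primal_dual_iterates f g K gamma rho0 tau x0 y0 x xh xt y yt yb.
Hypotheses (tau0 : tau 0%N = 1) (tau01 : forall k, (0 < k)%N -> 0 < tau k < 1).
Hypotheses (fpcc : proper_closed_convex f) (gpcc : proper_closed_convex g).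
Hypothesis (rho00 : 0 < rho0).

Lemma tau_gt0 k : 0 < tau k.
Proof. by case: k => [|k]; [rewrite tau0|have /andP[] := tau01 (ltn0Sn k)]. Qed.

Lemma rho_gt0 k : 0 < rho k.
Proof. by rewrite divr_gt0 ?exprn_gt0 ?tau_gt0. Qed.

Lemma xh_average k : xh k = (1 - tau k) *: x k + tau k *: xt k.
Proof.
case: k => [|k]; last exact: (step_xh it).
by have [-> -> ->] := init_x it; rewrite tau0 subrr scale0r add0r scale1r.
Qed.

(** The rule for yt, rewritten in terms of the infeasibility. The case
k = 0, where k.-1 = 0, fits in because [split_iterate] reads k - 1 the same
way. *)
Lemma yt_increment k : yt k.+1 = yt k
  + ((1 - gamma) * rho k) *: (infeasibility k.+1 - (1 - tau k) *: infeasibility k).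
Proof.
rewrite (step_yt it) /infeasibility /split_iterate /= /eta_seq -/rho -addrA; congr (_ + _).
have := rho_gt0 k; have := rho_gt0 k.-1; have := tau_gt0 k; have := tau_gt0 k.-1.
rewrite !mulmxBr -scalemxAr mulmxBr /rho /rho_seq => t1 t2 r1 r2.
move: (K *m _) (K *m _) (K *m _) (K *m _) => k1 k2 k3 k4.
by apply/matrixP => i j; rewrite !mxE; field; rewrite !gt_eqF.
Qed.

Variables (muf : R) (xstar : 'cV[R]_p).
Hypotheses (gamma01 : 2^-1 < gamma < 1) (K0 : 0 < opnorm K) (mu0 : 0 <= muf)
  (fconv : strongly_convex muf f) (gsy : dom (conjugate g) ystar)
  (fxs : dom f xstar) (gKxs : dom g (K *m xstar))
  (sE : s = fine (f xstar) + fine (g (K *m xstar))).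

Lemma dual_prox k : dom (conjugate g) (y k.+1) /\
  forall u, dom (conjugate g) u ->
    fine (conjugate g (y k.+1)) + dot (split_iterate k.+1) (u - y k.+1)
      <= fine (conjugate g u).
Proof.
have [gprop _ _] := gpcc; have rk := rho_gt0 k.
have [||||gy hy] := prox_variational _ _ _ _ (step_y it k) (mu := 0).
- by move=> u; exact: conjugate_gtNy.
- by exists ystar.
- exact/strongly_convex0/conjugate_convex.
- exact: rk.
split=> // u gu; have := hy u gu; rewrite !mul0r addr0.
rewrite -/rho; have -> // : (rho k)^-1 *: (yt k + rho k *: (K *m xh k) - y k.+1) =
    split_iterate k.+1.
rewrite /split_iterate /=; move: (K *m _) => k1.
by apply/matrixP => i j; rewrite !mxE; field; rewrite gt_eqF.
Qed.

Lemma primal_prox k : dom f (x k.+1) /\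
  forall u, dom f u -> fine (f (x k.+1))
      + dot ((rho k * opnorm K ^+ 2) *: (xh k - x k.+1) - K^T *m y k.+1) (u - x k.+1)
    <= fine (f u).
Proof.
have [fprop _ _] := fpcc; have rk := rho_gt0 k.
have aL : 0 < rho k * opnorm K ^+ 2 by rewrite mulr_gt0 ?exprn_gt0.
have [||||fx hx] := prox_variational _ _ _ _ (step_x it k) (mu := muf).
- exact: fprop.1.
- by exists xstar.
- exact: fconv.
- by rewrite invr_gt0.
split=> // u fu; apply: le_trans (hx u fu).
rewrite -/rho scaled_residual ?invr_eq0 ?gt_eqF // invrK.
by rewrite lerDl mulr_ge0 ?dot_ge0 // divr_ge0.
Qed.

Lemma anchor_prox k : dom f (xt k.+1) /\
  forall u, dom f u -> fine (f (xt k.+1))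
      + dot ((tau k * (rho k * opnorm K ^+ 2) / relax gamma) *: (xt k - xt k.+1)
             - K^T *m y k.+1) (u - xt k.+1)
      + muf / 2 * dot (u - xt k.+1) (u - xt k.+1)
    <= fine (f u).
Proof.
have [fprop _ _] := fpcc; have rk := rho_gt0 k; have tk := tau_gt0 k.
have /andP[gam1 gam2] := gamma01.
have Gam0 : 0 < relax gamma by rewrite /relax subr_gt0 invf_plt ?posrE //; lra.
have aL : 0 < rho k * opnorm K ^+ 2 by rewrite mulr_gt0 ?exprn_gt0.
have lam0 : 0 < beta_seq K gamma rho0 tau k / tau k by rewrite !divr_gt0.
have [||||fx hx] := prox_variational _ _ _ _ (step_xt it k) (mu := muf).
- exact: fprop.1.
- by exists xstar.
- exact: fconv.
- exact: lam0.
split=> // u fu; apply: le_trans (hx u fu).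
rewrite scaled_residual ?gt_eqF //.
have -> : (beta_seq K gamma rho0 tau k / tau k)^-1 =
    tau k * (rho k * opnorm K ^+ 2) / relax gamma => //.
by rewrite /beta_seq -/rho; field; rewrite !gt_eqF.
Qed.

(** Fenchel's inequality for the conjugate of g, between y k and ystar. *)
Lemma split_gap_ge k : fine (f (x k.+1)) + dot (K *m x k.+1) ystar
  - fine (conjugate g ystar) - s <= split_gap k.+1.
Proof.
have [_ /(_ _ gsy)] := dual_prox k.
rewrite /split_gap /infeasibility; move: (split_iterate k.+1) => r.
rewrite !dotE !(dotC r); lra.
Qed.

(** The one-step estimate: [primal_step] for f, two Fenchel inequalities for g
(at the previous split iterate and at the solution), [dual_step] for the
multipliers, and [relaxation_absorbs_displacement] for what is left over. *)
Lemma split_gap_step k :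
  split_gap k.+1 + rho k / 2 * dot (infeasibility k.+1) (infeasibility k.+1)
    + dot (ystar - yt k.+1) (ystar - yt k.+1) / (2 * ((1 - gamma) * rho k))
    + (tau k ^+ 2 * (rho k * opnorm K ^+ 2) / 2 / relax gamma + tau k * muf / 2)
        * dot (xstar - xt k.+1) (xstar - xt k.+1)
  <= (1 - tau k) * split_gap k
    + rho k / 2 * (1 - tau k) ^+ 2 * dot (infeasibility k) (infeasibility k)
    + dot (ystar - yt k) (ystar - yt k) / (2 * ((1 - gamma) * rho k))
    + tau k ^+ 2 * (rho k * opnorm K ^+ 2) / 2 / relax gamma
        * dot (xstar - xt k) (xstar - xt k).
Proof.
have [fprop _ _] := fpcc; have [gprop _ _] := gpcc.
have rk := rho_gt0 k; have tk := tau_gt0 k.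
have tk1 : tau k <= 1.
  by case: (k) => [|j]; [rewrite tau0|have /andP[_ /ltW] := tau01 (ltn0Sn j)].
have /andP[gam1 gam2] := gamma01.
have [fx hx] := primal_prox k; have [fxt hxt] := anchor_prox k.
have [gy hy] := dual_prox k.
pose z := (1 - tau k) *: x k + tau k *: xt k.+1.
have [fz zle] : dom f z /\
    fine (f z) <= (1 - tau k) * fine (f (x k)) + tau k * fine (f (xt k.+1)).
  (* at k = 0, x k may lie outside the domain of f, but z does not depend on it *)
  rewrite /z; case: (k) fxt => [|j] fxt.
    by rewrite tau0 subrr scale0r add0r scale1r mul0r add0r mul1r.
  have /andP[t0 t1] := tau01 (ltn0Sn j).
  have [fxj _] := primal_prox j.
  have [|fz zle] := strongly_convex_fine (t := 1 - tau j.+1) fprop.1 fconv fxj fxt; first lra.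
  rewrite subKr in fz zle; split=> //; apply: le_trans zle _.
  by rewrite gerBl mulr_ge0 ?dot_ge0 // mulr_ge0 ?divr_ge0 // mulr_ge0; lra.
have := hx _ fz; rewrite xh_average => hxz.
have P := primal_step (phi := fun u => fine (f u)) (ltW tk) hxz zle (hxt _ fxs).
have G1 : (1 - tau k) * (dot (y k.+1) (split_iterate k) - fine (conjugate g (y k.+1)))
    <= (1 - tau k) * (dot (y k) (split_iterate k) - fine (conjugate g (y k))).
  case: (k) gy => [|j] gy; first by rewrite tau0 subrr !mul0r.
  have /andP[_ t1] := tau01 (ltn0Sn j).
  rewrite ler_wpM2l //; first lra.
  have [_ /(_ _ gy)] := dual_prox j; move: (split_iterate j.+1) => r.
  rewrite !dotE !(dotC r); lra.
have G2 : tau k * (dot (y k.+1) (K *m xstar) - fine (conjugate g (y k.+1)))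
    <= tau k * fine (g (K *m xstar)).
  rewrite ler_wpM2l ?(ltW tk) //.
  have := fenchel_young g (K *m xstar) (y k.+1).
  rewrite -(dom_fine gprop.1 gKxs) -(dom_fine _ gy) => [|u]; last exact: conjugate_gtNy.
  by rewrite -EFinB lee_fin dotC; lra.
pose d := x k.+1 - xh k.
have Kd : rho k / 2 / gamma * dot (K *m d) (K *m d) <=
    rho k / 2 / gamma * (opnorm K ^+ 2 * dot d d).
  rewrite ler_pM2l; last by apply: divr_gt0; [exact: divr_gt0|lra].
  rewrite -!enorm_sqr -exprMn ler_sqr ?nnegrE ?mulr_ge0 ?enorm_ge0 ?enorm_mulmx //.
  exact: ltW.
have gam0 : 0 < gamma < 1 by lra.
have D := dual_step (K *m d) ystar gam0 rk (yt_increment k).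
have yE : yt k + rho k *: (infeasibility k.+1 - K *m d) = y k.+1.
  rewrite /infeasibility /split_iterate /d mulmxBr /=.
  move: (K *m x k.+1) (K *m xh k) => k1 k2.
  by apply/matrixP => i j; rewrite !mxE; field; rewrite gt_eqF.
rewrite yE in D.
have A := relaxation_absorbs_displacement d (z - x k.+1) gamma01.
have C0 : 0 <= rho k * opnorm K ^+ 2 / 2.
  by apply: divr_ge0 => //; apply: mulr_ge0; [exact: ltW|exact: sqr_ge0].
have {C0}A := ler_wpM2l C0 A; rewrite mulr0 in A.
have eD : dot (ystar - y k.+1) (infeasibility k.+1 - (1 - tau k) *: infeasibility k) =
    dot (infeasibility k.+1) ystar - (1 - tau k) * dot (infeasibility k) ystar
    - (dot (y k.+1) (K *m x k.+1) - dot (y k.+1) (split_iterate k.+1)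
       - (1 - tau k) * (dot (y k.+1) (K *m x k) - dot (y k.+1) (split_iterate k))).
  rewrite !(dotC (infeasibility _)) /infeasibility.
  move: (split_iterate _) (split_iterate _) (K *m x k.+1) (K *m x k) => r1 r2 k1 k2.
  by rewrite !dotE; ring.
have eP : dot (y k.+1)
      (K *m x k.+1 - (1 - tau k) *: (K *m x k) - tau k *: (K *m xstar)) =
    dot (y k.+1) (K *m x k.+1) - (1 - tau k) * dot (y k.+1) (K *m x k)
    - tau k * dot (y k.+1) (K *m xstar).
  by rewrite !dotDr !dotNr !dotZr.
move: P; rewrite -xh_average -/d -/z eP; move: G1 G2 Kd D A; rewrite eD.
by rewrite /split_gap sE; lra.
Qed.

(** A subgradient of g at K x of norm at most Mg, tested against the Fenchel
equality at y, compares g (K x) with the value of g at the split iterate. *)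
Lemma primal_gap_le (Mg : R) k : 0 <= Mg -> lipschitz_on_dom Mg g ->
  dom g (K *m x k.+1) ->
  fine (f (x k.+1)) + fine (g (K *m x k.+1)) - s
    <= split_gap k.+1 + (enorm ystar + Mg) * enorm (infeasibility k.+1).
Proof.
move=> M0 glip gKx; have [gprop _ gconv] := gpcc.
have [w wM hw] := lipschitz_subgradient gprop.1 gconv M0 glip gKx.
have gw : (conjugate g w <= (dot (K *m x k.+1) w - fine (g (K *m x k.+1)))%:E)%E.
  apply: ge_ereal_sup => _ [v _ <-].
  have [gv|/notin_dom ->] := pselect (dom g v); last by rewrite addeNy leNye.
  rewrite -(dom_fine gprop.1 gv) -EFinB lee_fin.
  have := hw v gv; rewrite !dotE; lra.
have dgw : dom (conjugate g) w by exact: le_lt_trans gw (ltry _).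
rewrite -(dom_fine _ dgw) in gw; last by move=> u; exact: conjugate_gtNy.
rewrite lee_fin in gw; have [_ /(_ w dgw)] := dual_prox k.
have : dot (infeasibility k.+1) w <= Mg * enorm (infeasibility k.+1).
  apply: le_trans (dot_le_enorm _ _) _.
  by rewrite mulrC ler_wpM2r ?enorm_ge0.
have := dot_le_enorm (- infeasibility k.+1) ystar.
rewrite enormN dotNl (mulrC (enorm _)) /split_gap.
have -> : dot (infeasibility k.+1) w = dot (K *m x k.+1) w - dot (split_iterate k.+1) w.
  by rewrite dotDl dotNl.
rewrite dotDr dotNr (dotC (y k.+1)); lra.
Qed.

End Iterates.

(** * Decrease of the potential *)

(** The scalar recursion behind the rates. In the application l is the gap of
the Lagrangian of the split problem, S the squared norm of the infeasibility,
E and X are the squared distances of yt and xt to the dual and to the primal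
solution, and L is the squared norm of K. The starting point need not lie in
the domain of f, so l 0 carries no information; its weight is always 0. *)
Section Descent.
Context {R : realType}.
Variables (c rho0 gamma Gam L mu : R) (l S E X : nat -> R).
Let tau (k : nat) : R := c / (k%:R + c).
Let rho k := rho0 / tau k ^+ 2.
Let B := (c - 1) / 2 * ((c - 1) * rho0 * L / Gam + c * mu) * X 0%N
  + c ^+ 2 / (2 * (1 - gamma) * rho0) * E 0%N.

Hypotheses (c2 : 2 < c) (rho00 : 0 < rho0) (gamma1 : gamma < 1) (Gam0 : 0 < Gam)
  (L0 : 0 <= L) (mu0 : 0 <= mu)
  (rho0_le : rho0 * L * (2 * c - 1) <= c * (c - 1) * Gam * mu)
  (l0 : forall k, (0 < k)%N -> 0 <= l k) (S0 : forall k, 0 <= S k)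
  (E0 : forall k, 0 <= E k) (X0 : forall k, 0 <= X k).
Hypothesis step : forall k,
  l k.+1 + rho k / 2 * S k.+1 + E k.+1 / (2 * ((1 - gamma) * rho k))
    + (tau k ^+ 2 * (rho k * L) / 2 / Gam + tau k * mu / 2) * X k.+1
  <= (1 - tau k) * l k + rho k / 2 * (1 - tau k) ^+ 2 * S k
    + E k / (2 * ((1 - gamma) * rho k))
    + tau k ^+ 2 * (rho k * L) / 2 / Gam * X k.

Local Ltac hypotheses_to_context :=
  move: (c2) (rho00) (gamma1) (Gam0) (L0) (mu0) => hc hrho hgam hGam hL hmu.

Let b := rho0 / (2 * c ^+ 2).
Let e := c ^+ 2 / (2 * (1 - gamma) * rho0).
Let q := rho0 * L / (2 * Gam).

(** The inequality [step] times (k + c) ^ 2 = (c / tau k) ^ 2, which makes all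
weights polynomials in k. *)
Let scaled_step k :
  (k%:R + c) ^+ 2 * l k.+1 + b * (k%:R + c) ^+ 4 * S k.+1 + e * E k.+1
    + (q * (k%:R + c) ^+ 2 + c * mu * (k%:R + c) / 2) * X k.+1
  <= k%:R * (k%:R + c) * l k + b * (k%:R * (k%:R + c)) ^+ 2 * S k + e * E k
    + q * (k%:R + c) ^+ 2 * X k.
Proof.
hypotheses_to_context.
have k0 : 0 <= k%:R :> R by rewrite ler0n.
have kc : 0 < k%:R + c by lra.
have := ler_wpM2l (ltW (exprn_gt0 2 kc)) (step k).
have c0 : c != 0 by rewrite gt_eqF; lra.
have g0 : 1 - gamma != 0 by rewrite gt_eqF; lra.
congr (_ <= _); rewrite /rho /tau /b /e /q; field.
all: by rewrite !gt_eqF //=; lra.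
Qed.

(** The weights make potential k.+1 bounded by the right-hand side of
[scaled_step k]. Those of l and S exceed what that right-hand side asks for by
amounts of order k and k ^ 3: the gain that is summed below. *)
Definition potential k :=
  (k%:R + c - 1) ^+ 2 * l k + b * (k%:R + c - 1) ^+ 4 * S k + e * E k
  + q * (k%:R + c) ^+ 2 * X k.

Let e0 : 0 <= e.
Proof. hypotheses_to_context; by rewrite divr_ge0 ?sqr_ge0 // mulr_ge0; lra. Qed.

Let b0 : 0 <= b.
Proof. hypotheses_to_context; by rewrite divr_ge0 ?mulr_ge0 ?sqr_ge0; lra. Qed.

Let q0 : 0 <= q.
Proof. hypotheses_to_context; by rewrite divr_ge0 ?mulr_ge0; lra. Qed.

Let summand_ge0 k : (0 < k)%N -> 0 <= k%:R * l k + b * k%:R ^+ 3 * S k.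
Proof.
move=> k0; apply: addr_ge0; apply: mulr_ge0; rewrite ?l0 ?S0 //.
exact: mulr_ge0 b0 (exprn_ge0 _ (ler0n _ _)).
Qed.

(** The strong convexity pays for the growth of the weight of the distance to
the solution; this is what the bound on rho0 is for. *)
Let potential_le k : potential k.+1 <=
  k%:R * (k%:R + c) * l k + b * (k%:R * (k%:R + c)) ^+ 2 * S k + e * E k
    + q * (k%:R + c) ^+ 2 * X k.
Proof.
hypotheses_to_context.
apply: le_trans (scaled_step k).
have k0 : 0 <= k%:R :> R by rewrite ler0n.
rewrite /potential -natr1; move: (k%:R : R) k0 => k' k0.
have -> : k' + 1 + c - 1 = k' + c by ring.
rewrite lerD2l ler_wpM2r //.
have : 2 * q * Gam * (2 * c - 1) <= c * (c - 1) * Gam * mu.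
  by have -> : 2 * q * Gam = rho0 * L by rewrite /q; field; rewrite gt_eqF.
rewrite -mulrA (mulrC Gam) [leRHS]mulrAC mulrA ler_pM2r // => h.
have kc : 0 <= k' + c by lra.
have c1 : 0 < c - 1 by lra.
have qk : 0 <= q * (k' + 1) by rewrite mulr_ge0 //; lra.
rewrite -subr_ge0 -(pmulr_rge0 _ c1).
have := ler_wpM2r kc h; lra.
Qed.

(** At k = 0 the terms in l and S have weight 0, so that no initial gap enters.
The bound on rho0 compares the remaining weights. *)
Lemma potential1_le : potential 1 <= B.
Proof.
hypotheses_to_context.
apply: le_trans (potential_le 0) _; rewrite mul0r !mul0r expr0n mulr0 mul0r !add0r.
rewrite addrC /B lerD2r ler_wpM2r //.
have -> : q * c ^+ 2 = rho0 * L / Gam * c ^+ 2 / 2 by rewrite /q; field; rewrite gt_eqF.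
have : rho0 * L / Gam * (2 * c - 1) <= c * (c - 1) * mu.
  rewrite mulrAC ler_pdivrMr //; move: rho0_le; lra.
have -> : (c - 1) * rho0 * L / Gam = (c - 1) * (rho0 * L / Gam) by rewrite !mulrA.
move: (rho0 * L / Gam) => a; nra.
Qed.

Lemma potential_decrease k : (0 < k)%N ->
  potential k.+1 + (c - 2) * (k%:R * l k + b * k%:R ^+ 3 * S k) <= potential k.
Proof.
hypotheses_to_context.
move=> k1; have k1' : 1 <= k%:R :> R by rewrite ler1n.
have := potential_le k; have := l0 k1; have := S0 k.
rewrite [potential k]/potential; move: (potential k.+1) (E k) (X k) => P Ek Xk.
move: (l k) (S k) (k%:R : R) k1' => lk Sk k' k1' Sk0 lk0 h.
have gap : k' * (k' + c) + (c - 2) * k' <= (k' + c - 1) ^+ 2 by nra.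
have hl : (k' * (k' + c) + (c - 2) * k') * lk <= (k' + c - 1) ^+ 2 * lk.
  by rewrite ler_wpM2r.
have hS : b * ((k' * (k' + c)) ^+ 2 + (c - 2) * k' ^+ 3) * Sk <=
    b * (k' + c - 1) ^+ 4 * Sk.
  rewrite ler_wpM2r // ler_wpM2l //.
  have -> : (k' + c - 1) ^+ 4 = ((k' + c - 1) ^+ 2) ^+ 2 by rewrite -exprM.
  have h1 : 0 <= k' * (k' + c) by rewrite mulr_ge0; lra.
  have h2 : 0 <= (c - 2) * k' by rewrite mulr_ge0; lra.
  apply: (@le_trans _ _ ((k' * (k' + c) + (c - 2) * k') ^+ 2)).
    have h3 : 0 <= (c - 2) * k' ^+ 2 * (k' + 2 * c) by rewrite !mulr_ge0 ?sqr_ge0; lra.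
    have := sqr_ge0 ((c - 2) * k'); lra.
  by rewrite ler_sqr ?nnegrE //; nra.
lra.
Qed.

Lemma potential_ge_gap k : (0 < k)%N ->
  (k%:R + c - 1) ^+ 2 * l k + b * (k%:R + c - 1) ^+ 4 * S k <= potential k.
Proof.
hypotheses_to_context.
move=> k1; rewrite /potential -[leRHS]addrA lerDl.
exact: addr_ge0 (mulr_ge0 e0 (E0 k)) (mulr_ge0 (mulr_ge0 q0 (sqr_ge0 _)) (X0 k)).
Qed.

Lemma potential_sum m n : (0 < m)%N -> (m <= n)%N ->
  potential n + (c - 2) * \sum_(m <= k < n) (k%:R * l k + b * k%:R ^+ 3 * S k)
  <= potential m.
Proof.
hypotheses_to_context.
move=> m0 mn; rewrite -(subnKC mn); elim: (n - m)%N => [|j IHj].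
  by rewrite addn0 big_geq // mulr0 addr0.
rewrite addnS big_nat_recr ?leq_addr //= mulrDr.
have := @potential_decrease (m + j) (leq_trans m0 (leq_addr _ _)); lra.
Qed.

Lemma gap_bound k : (0 < k)%N ->
  (k%:R + c - 1) ^+ 2 * l k + b * (k%:R + c - 1) ^+ 4 * S k <= B.
Proof.
hypotheses_to_context.
move=> k1; apply: le_trans (potential_ge_gap k1) _; apply: le_trans potential1_le.
apply: le_trans (potential_sum (ltn0Sn 0) k1); rewrite lerDl mulr_ge0 //; first lra.
rewrite big_nat_cond sumr_ge0 // => i /andP[/andP[i0 _] _].
exact: summand_ge0.
Qed.

Lemma gap_summable m n : (0 < m)%N ->
  \sum_(m <= k < n) (k%:R * l k + b * k%:R ^+ 3 * S k) <= B / (c - 2).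
Proof.
hypotheses_to_context.
move=> m0; have c20 : 0 < c - 2 by lra.
have pos k : (0 < k)%N ->
    0 <= (k%:R + c - 1) ^+ 2 * l k + b * (k%:R + c - 1) ^+ 4 * S k.
  move=> k0; exact: addr_ge0 (mulr_ge0 (sqr_ge0 _) (l0 k0))
    (mulr_ge0 (mulr_ge0 b0 (@exprn_even_ge0 _ 4 _ isT)) (S0 _)).
have B0 : 0 <= B by exact: le_trans (pos _ (ltn0Sn 0)) (gap_bound _).
have [nm|mn] := leqP n m; first by rewrite big_geq // divr_ge0 // ltW.
rewrite ler_pdivlMr // mulrC.
have := potential_sum m0 (ltnW mn).
have := potential_sum (ltn0Sn 0) m0.
have := potential1_le.
have n0 := leq_trans m0 (ltnW mn).
have := le_trans (pos n n0) (potential_ge_gap n0).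
have : 0 <= (c - 2) * \sum_(1 <= k < m) (k%:R * l k + b * k%:R ^+ 3 * S k).
  rewrite mulr_ge0 ?(ltW c20) //.
  rewrite big_nat_cond sumr_ge0 // => i /andP[/andP[i0 _] _].
  exact: summand_ge0.
lra.
Qed.

End Descent.

(** * Inferior limits *)

Section LimitInferior.
Context {R : realType}.

Lemma limn_einf_eq0 (u : nat -> \bar R) :
  (\forall k \near \oo, (0 <= u k)%E) ->
  (forall e : R, 0 < e -> forall N, exists2 k, (N <= k)%N & (u k <= e%:E)%E) ->
  limn_einf u = 0%E.
Proof.
move=> [N0 _ u0] usmall; rewrite limn_einf_lim.
apply: lim_near_cst => //; exists N0 => // m /= Nm.
apply/eqP; rewrite eq_le; apply/andP; split; last first.
  by apply: le_ereal_inf_tmp => _ [k /= mk <-]; apply: u0; exact: leq_trans mk.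
apply/lee_addgt0Pr => e e0; rewrite add0e.
have [k mk] := usmall e e0 m; apply: le_trans.
by apply: ereal_inf_lbound; exists k.
Qed.

(** By ln (1 + t) <= t, used for both logarithms. Summed up, this makes the
series of 1 / (k ln k) diverge. *)
Lemma lnln_increment (k : nat) : (2 <= k)%N ->
  ln (ln (k.+1%:R : R)) - ln (ln k%:R) <= (k%:R * ln k%:R)^-1.
Proof.
move=> k2; have k0 : 0 < k%:R :> R by rewrite ltr0n; case: k k2.
have lk : 0 < ln (k%:R : R) by rewrite ln_gt0 // ltr1n.
have lk1 : 0 < ln (k.+1%:R : R) by rewrite ln_gt0 // ltr1n ltnS; case: k k2 {k0 lk}.
have dln : ln (k.+1%:R : R) <= ln k%:R + k%:R^-1.
  have -> : k.+1%:R = k%:R * (1 + k%:R^-1) :> R.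
    by rewrite mulrDr mulr1 mulfV ?gt_eqF // -natr1.
  have k1 : 0 < 1 + k%:R^-1 :> R by rewrite addr_gt0 ?invr_gt0.
  rewrite lnM ?posrE //.
  by rewrite lerD2l le_ln1Dx // (lt_trans (ltrN10 _)) ?invr_gt0.
rewrite -ln_div ?posrE //.
have -> : ln k.+1%:R / ln k%:R = 1 + (ln k.+1%:R / ln k%:R - 1) :> R by rewrite addrC subrK.
apply: le_trans (le_ln1Dx _) _.
  by rewrite -subr_gt0 opprK subrK divr_gt0.
by rewrite lerBlDl ler_pdivrMr // mulrDl mul1r invfM mulfVK ?gt_eqF.
Qed.

(** Otherwise a k would eventually dominate e / (k ln k), the general term of
a divergent series. *)
Lemma bounded_series_liminf (a : nat -> R) (B : R) :
  (forall k, 0 <= a k) -> (forall m n, (0 < m)%N -> \sum_(m <= k < n) a k <= B) ->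
  forall e, 0 < e -> forall N, exists2 k, (N <= k)%N & k%:R * ln k%:R * a k <= e.
Proof.
move=> a0 aB e e0 N; apply: contrapT => no.
pose m := maxn N 2; have m2 : (2 <= m)%N by rewrite leq_maxr.
have big k : (m <= k)%N -> e / (k%:R * ln k%:R) <= a k.
  move=> mk; have k2 := leq_trans m2 mk.
  have kl : 0 < k%:R * ln k%:R :> R.
    by rewrite mulr_gt0 ?ln_gt0 ?ltr1n // ltr0n; case: k k2 {mk}.
  rewrite ler_pdivrMr // mulrC leNgt; apply/negP => lt.
  by apply: no; exists k; [exact: leq_trans (leq_maxl _ _) mk|exact: ltW].
have tele n : (m <= n)%N -> e * (ln (ln (n%:R : R)) - ln (ln m%:R)) <= B.
  move=> mn; apply: le_trans (aB m n (ltnW m2)).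
  rewrite -(@telescope_sumr _ m n (fun k => ln (ln (k%:R : R)))) // mulr_sumr.
  apply: ler_sum_nat => k /andP[mk _]; apply: le_trans (big k mk).
  by rewrite ler_pM2l // lnln_increment // (leq_trans m2).
pose T := expR (expR (B / e + ln (ln m%:R) + 1)).
pose n := maxn m (Num.truncn T).+1.
have Tn : T < n%:R.
  apply: lt_le_trans (truncnS_gt _) _.
  by rewrite ler_nat leq_maxr.
have := tele n (leq_maxl _ _).
have : B / e + ln (ln m%:R) + 1 < ln (ln (n%:R : R)).
  have n0 : 0 < n%:R :> R by rewrite (lt_trans _ Tn) // expR_gt0.
  have lTn : expR (B / e + ln (ln m%:R) + 1) < ln n%:R.
    by rewrite -[ltLHS]expRK ltr_ln ?posrE ?expR_gt0.
  rewrite -[ltLHS]expRK ltr_ln ?posrE ?expR_gt0 //; apply: lt_trans lTn; exact: expR_gt0.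
rewrite -ler_pdivlMl // mulrC; lra.
Qed.

End LimitInferior.

(** With r the square root of ln k >= 1, the hypothesis controls
r * (k ^ 2 r l) and b * (k ^ 2 r t) ^ 2, hence both terms of the conclusion.
Bounding the square of t costs half of the logarithm. *)
Lemma weighted_sqrt_small {R : realType} (b C e : R) : 0 < b -> 0 <= C -> 0 < e ->
  exists2 d, 0 < d & forall k (l t : R), expR 1 <= k -> 0 <= l -> 0 <= t ->
    k * ln k * (k * l + b * k ^+ 3 * t ^+ 2) <= d ->
    k ^+ 2 * Num.sqrt (ln k) * (l + C * t) <= e.
Proof.
move=> b0 C0 e0; pose u := e / (2 * (C + 1)).
have u0 : 0 < u by rewrite divr_gt0 // mulr_gt0 //; lra.
have bu0 : 0 < b * u ^+ 2 by rewrite mulr_gt0 ?exprn_gt0.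
exists (Num.min (e / 2) (b * u ^+ 2)) => [|k l t k1 l0 t0].
  by rewrite lt_min bu0 divr_gt0.
have k0 : 0 < k := lt_le_trans (expR_gt0 1) k1.
have lk1 : 1 <= ln k by rewrite -[leLHS]expRK ler_ln ?posrE ?expR_gt0.
have k20 : 0 <= k ^+ 2 by rewrite sqr_ge0.
set r := Num.sqrt (ln k).
have r1 : 1 <= r by rewrite -sqrtr1 ler_wsqrtr.
have r2 : r ^+ 2 = ln k by rewrite sqr_sqrtr; lra.
rewrite le_min -r2 => /andP[h1 h2].
have a1 : k * r ^+ 2 * (k * l + b * k ^+ 3 * t ^+ 2) =
    r * (k ^+ 2 * r * l) + b * (k ^+ 2 * r * t) ^+ 2 by ring.
rewrite a1 in h1 h2.
have c0 : 0 <= k ^+ 2 * r * l by rewrite !mulr_ge0 //; lra.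
have d0 : 0 <= k ^+ 2 * r * t by rewrite !mulr_ge0 //; lra.
have q0 : 0 <= b * (k ^+ 2 * r * t) ^+ 2 by rewrite mulr_ge0 ?sqr_ge0 ?ltW.
have le1 : k ^+ 2 * r * l <= e / 2 by nra.
have le2 : k ^+ 2 * r * t <= u.
  rewrite -ler_sqr ?nnegrE ?(ltW u0) // -(ler_pM2l b0); nra.
have : C * u <= e / 2.
  have -> : C * u = e / 2 * (C / (C + 1)) by rewrite /u; field; lra.
  by rewrite ler_piMr ?divr_ge0 ?(ltW e0) // ler_pdivrMr; lra.
have := ler_wpM2l C0 le2; rewrite mulrDr; lra.
Qed.

Lemma lee_divr {R : realType} (a r : R) (x : \bar R) :
  0 < r -> (a%:E <= x)%E -> ((a / r)%:E <= x / r%:E)%E.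
Proof.
move=> r0 ax; rewrite inver gt_eqF // EFinM lee_wpmul2r // lee_fin invr_ge0.
exact: ltW.
Qed.

(** * Convergence rates *)

Theorem theorem4p4 (R : realType) (p n : nat)
    (f : 'cV[R]_p -> \bar R) (g : 'cV[R]_n -> \bar R) (K : 'M[R]_(n, p))
    (muf gamma c rho0 : R) (xstar x0 : 'cV[R]_p) (ystar y0 : 'cV[R]_n)
    (x xh xt : nat -> 'cV[R]_p) (y yt yb : nat -> 'cV[R]_n)
    (F := primal_obj f g K) (Fstar := primal_value f g K)
    (Lag := lagrangian f g K)
    (Gamma := relax gamma)
    (tau := fun k : nat => c / (k%:R + c))
    (R0sq := ((c - 1)%:E * (F x0 - Fstar)
       + ((c - 1) / 2 * ((c - 1) * rho0 * opnorm K ^+ 2 / Gamma + c * muf)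
            * enorm (x0 - xstar)%R ^+ 2)%:E
       + (c ^+ 2 / (2 * (1 - gamma) * rho0) * enorm (y0 - ystar)%R ^+ 2)%:E)%E) :
  proper_closed_convex f -> proper_closed_convex g ->
  argmin F !=set0 ->
  relint [set v - K *m u | v in dom g & u in dom f] 0 ->
  0 < muf -> strongly_convex muf f ->
  argmin F xstar -> argmin (dual_obj f g K) ystar ->
  2^-1 < gamma < 1 -> 2 < c ->
  0 < rho0 <= c * (c - 1) * Gamma * muf / ((2 * c - 1) * opnorm K ^+ 2) ->
  primal_dual_iterates f g K gamma rho0 tau x0 y0 x xh xt y yt yb ->
  [/\ (forall k : nat, (1 <= k)%N ->
         0 <= Lag (x k) ystar - Fstar <= R0sq / ((k%:R + c - 1) ^+ 2)%:E)%E,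
      limn_einf (fun k : nat =>
        (k%:R ^+ 2 * ln k%:R)%:E * (Lag (x k) ystar - Fstar))%E = 0%E
    & forall Mg : R, 0 <= Mg -> lipschitz_on_dom Mg g ->
      let R1sq := (R0sq + (Num.sqrt (2 * c ^+ 2 / rho0) * (enorm ystar + Mg))%:E
                            * sqrte R0sq)%E in
      (* When dom g is not the whole space, K x^k may leave it, and then
         F (x k) = +oo. *)
      (forall k : nat, (1 <= k)%N ->
         (0 <= F (x k) - Fstar)%E /\
         (dom g (K *m x k) ->
            F (x k) - Fstar <= R1sq / ((k%:R + c - 1) ^+ 2)%:E)%E) /\
      ((\forall k \near \oo, dom g (K *m x k)) ->
         limn_einf (fun k : nat =>
           (k%:R ^+ 2 * Num.sqrt (ln k%:R))%:E * (F (x k) - Fstar))%E = 0%E)].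
Proof.
move=> fpcc gpcc _ ri muf0 fconv xs_min ys_min gamma01 c2 rho0_bnd it.
have [fprop _ fconvex] := fpcc; have [gprop _ gconvex] := gpcc.
have /andP[gam1 gam2] := gamma01; have /andP[rho00 rho0_le] := rho0_bnd.
have Gam0 : 0 < Gamma by rewrite /Gamma /relax subr_gt0 invf_plt ?posrE //; lra.
have c1 : 0 < 2 * c - 1 by lra.
(* if K were 0, the upper bound on rho0 would be a quotient by 0, that is 0 *)
have K0 : 0 < opnorm K.
  rewrite lt0r opnorm_ge0 andbT; apply/eqP => K0; move: rho0_le.
  by rewrite K0 expr0n mulr0 invr0 mulr0; lra.
have rho0_le' : rho0 * opnorm K ^+ 2 * (2 * c - 1) <= c * (c - 1) * Gamma * muf.
  by rewrite -mulrA (mulrC (_ ^+ 2)) -ler_pdivlMr // mulr_gt0 ?exprn_gt0.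
have tau0 : tau 0%N = 1 by rewrite /tau add0r mulfV // gt_eqF //; lra.
have tau01 k : (0 < k)%N -> 0 < tau k < 1.
  move=> k0; have k1 : 0 < k%:R :> R by rewrite ltr0n.
  by rewrite /tau divr_gt0 ?ltr_pdivrMr; lra.
have [v0 gv0 [u0 fu0 vu0]] := relint_subset ri.
have {vu0}vu0 : v0 = K *m u0 by apply/eqP; rewrite -subr_eq0 vu0.
have [fxs gKxs] : dom f xstar /\ dom g (K *m xstar).
  have := xs_min u0; rewrite /F /primal_obj -vu0.
  rewrite -(dom_fine fprop.1 fu0) -(dom_fine gprop.1 gv0) -EFinD /dom /=.
  have := fprop.1 xstar; have := gprop.1 (K *m xstar).
  by case: (f xstar) => [a| |] //; case: (g _) => [b| |] // _ _ _; rewrite !ltry.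
pose s := fine (f xstar) + fine (g (K *m xstar)).
have FxsE : F xstar = s%:E.
  by rewrite /F /primal_obj -(dom_fine fprop.1 fxs) -(dom_fine gprop.1 gKxs).
have s_le u : (s%:E <= primal_obj f g K u)%E by rewrite -FxsE; exact: xs_min.
have FstarE : Fstar = s%:E.
  apply/eqP; rewrite eq_le; apply/andP; split.
    by rewrite -FxsE; apply: ereal_inf_lbound; exists xstar.
  by apply: le_ereal_inf_tmp => _ [u _ <-].
have [gsy saddle] := dual_solution_saddle fpcc gpcc ri s_le ys_min.
pose l := split_gap f g K rho0 tau x xh y yt ystar s.
pose A := infeasibility K rho0 tau x xh y yt.
pose D k := fine (f (x k)) + dot (K *m x k) ystar - fine (conjugate g ystar) - s.
have fx k : (0 < k)%N -> dom f (x k).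
  case: k => // k _.
  by have [] := primal_prox it tau0 tau01 fpcc rho00 K0 (ltW muf0) fconv fxs k.
have LagE k : (0 < k)%N -> (Lag (x k) ystar - Fstar = (D k)%:E)%E.
  move=> k0; rewrite /Lag /lagrangian FstarE -(dom_fine fprop.1 (fx k k0)).
  by rewrite -(dom_fine _ gsy) // => u; exact: conjugate_gtNy.
have D0 k : (0 < k)%N -> 0 <= D k.
  by move=> k0; rewrite subr_ge0; exact: saddle (fx k k0).
have Dl k : (0 < k)%N -> D k <= l k.
  case: k => // k _.
  exact: split_gap_ge it tau0 tau01 gpcc rho00 gsy k.
have l0 k : (0 < k)%N -> 0 <= l k by move=> k0; apply: le_trans (D0 k k0) (Dl k k0).
have step := split_gap_step it tau0 tau01 fpcc gpcc rho00 gamma01 K0 (ltW muf0)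
  fconv gsy fxs gKxs erefl.
(* R0sq without the initial gap, which is infinite when x0 is outside the domain
   of F: it bounds the iterates, and the limits follow even in that case *)
pose B := (c - 1) / 2 * ((c - 1) * rho0 * opnorm K ^+ 2 / Gamma + c * muf)
    * enorm (x0 - xstar) ^+ 2
  + c ^+ 2 / (2 * (1 - gamma) * rho0) * enorm (y0 - ystar) ^+ 2.
have BE : B = (c - 1) / 2 * ((c - 1) * rho0 * opnorm K ^+ 2 / Gamma + c * muf)
    * dot (xstar - xt 0%N) (xstar - xt 0%N)
  + c ^+ 2 / (2 * (1 - gamma) * rho0) * dot (ystar - yt 0%N) (ystar - yt 0%N).
  have [_ _ ->] := init_x it; have [_ -> _] := init_y it.
  by rewrite -!enorm_sqr -(enormN (xstar - x0)) opprB -(enormN (ystar - y0)) opprB.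
have bound := gap_bound c2 rho00 gam2 Gam0 (sqr_ge0 (opnorm K)) (ltW muf0) rho0_le'
  l0 (fun k => dot_ge0 (A k)) (fun k => dot_ge0 (ystar - yt k))
  (fun k => dot_ge0 (xstar - xt k)) step.
have summable := gap_summable c2 rho00 gam2 Gam0 (sqr_ge0 (opnorm K)) (ltW muf0) rho0_le'
  l0 (fun k => dot_ge0 (A k)) (fun k => dot_ge0 (ystar - yt k))
  (fun k => dot_ge0 (xstar - xt k)) step.
rewrite -BE in bound summable.
set b := rho0 / (2 * c ^+ 2) in bound summable.
have b0 : 0 < b by rewrite divr_gt0 // mulr_gt0 // exprn_gt0 //; lra.
have small := bounded_series_liminf
  (a := fun k => k%:R * l k + b * k%:R ^+ 3 * dot (A k) (A k)) _ summable.
have {}small e : 0 < e -> forall N, exists2 k, (N <= k)%N &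
    k%:R * ln k%:R * (k%:R * l k + b * k%:R ^+ 3 * enorm (A k) ^+ 2) <= e.
  move=> e0 N; have [|k Nk] := small _ e e0 N; last by exists k; rewrite // enorm_sqr.
  case=> [|k]; first by rewrite expr0n mulr0 !mul0r addr0.
  apply: addr_ge0; apply: mulr_ge0; rewrite ?l0 ?dot_ge0 //.
  by apply: mulr_ge0; [exact: ltW|exact: exprn_ge0].
have B_le : (B%:E <= R0sq)%E.
  rewrite /R0sq -addeA -EFinD -/B leeDr // mule_ge0 //; first by rewrite lee_fin; lra.
  by rewrite FstarE sube_ge0 // s_le.
have B0 : 0 <= B.
  have := bound 1%N isT; apply: le_trans.
  apply: addr_ge0; apply: mulr_ge0; rewrite ?l0 ?dot_ge0 ?sqr_ge0 //.
  by apply: mulr_ge0; [exact: ltW|exact: exprn_even_ge0].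
have R0sq0 : (0 <= R0sq)%E by apply: le_trans B_le; rewrite lee_fin.
have kc k : (0 < k)%N -> 0 < (k%:R + c - 1) ^+ 2.
  by move=> k0; rewrite exprn_gt0 //; have : 0 <= k%:R :> R by []; lra.
have l_le k : (0 < k)%N -> (k%:R + c - 1) ^+ 2 * l k <= B.
  move=> k0; apply: le_trans (bound k k0).
  rewrite lerDl; apply: mulr_ge0; last exact: dot_ge0.
  by apply: mulr_ge0; [exact: ltW|exact: exprn_even_ge0].
have lnk k : (0 < k)%N -> 0 <= ln k%:R :> R by move=> k0; rewrite ln_ge0 // ler1n.
split=> [k k0||Mg Mg0 glip R1sq].
- rewrite LagE // lee_fin D0 //=; apply: le_trans (lee_divr (kc k k0) B_le).
  rewrite lee_fin ler_pdivlMr ?kc // mulrC; apply: le_trans (l_le k k0).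
  by rewrite ler_pM2l ?kc // Dl.
- apply: limn_einf_eq0 => [|e e0 N].
    exists 1%N => // k /= k0; rewrite LagE // -EFinM lee_fin.
    by rewrite mulr_ge0 ?D0 // mulr_ge0 ?sqr_ge0 ?lnk.
  have [k] := small e e0 (maxn N 1); rewrite geq_max => /andP[Nk k0] le.
  exists k => //; rewrite LagE // -EFinM lee_fin; apply: le_trans le.
  rewrite [leRHS]mulrDr; apply: (@le_trans _ _ (k%:R * ln k%:R * (k%:R * l k))).
    have -> : k%:R ^+ 2 * ln k%:R * D k = k%:R * ln k%:R * k%:R * D k by ring.
    by rewrite !mulrA ler_wpM2l ?Dl // !mulr_ge0 ?lnk.
  rewrite lerDl; apply: mulr_ge0; first by rewrite mulr_ge0 ?lnk.
  apply: mulr_ge0; last exact: sqr_ge0.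
  by apply: mulr_ge0; [exact: ltW|exact: exprn_ge0].
have C0 : 0 <= enorm ystar + Mg by rewrite addr_ge0 ?enorm_ge0.
have Fpos k : (0 <= F (x k) - Fstar)%E by rewrite FstarE sube_ge0 ?s_le.
have F_le k : (0 < k)%N -> dom g (K *m x k) ->
    (F (x k) - Fstar <= (l k + (enorm ystar + Mg) * enorm (A k))%:E)%E.
  case: k => // k _ gKx; rewrite FstarE /F /primal_obj.
  rewrite -(dom_fine fprop.1 (fx k.+1 isT)) -(dom_fine gprop.1 gKx) -EFinD lee_fin.
  exact: primal_gap_le it tau0 tau01 gpcc rho00 gsy Mg k Mg0 glip gKx.
split=> [k k0|[N0 _ gK]].
  split=> // gKx; apply: le_trans (F_le k k0 gKx) _.
  have R1_le : ((B + Num.sqrt (2 * c ^+ 2 / rho0) * (enorm ystar + Mg) * Num.sqrt B)%:E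
      <= R1sq)%E.
    rewrite EFinD leeD // EFinM lee_wpmul2l ?lee_fin ?mulr_ge0 ?sqrtr_ge0 //.
    by rewrite -[leLHS]/(sqrte B%:E) lee_sqrt.
  apply: le_trans (lee_divr (kc k k0) R1_le).
  rewrite lee_fin ler_pdivlMr ?kc // mulrC mulrDr lerD ?l_le //.
  rewrite mulrCA [leRHS]mulrAC [leRHS]mulrC; apply: ler_wpM2l => //.
  have t0 : 0 <= (k%:R + c - 1) ^+ 2 * enorm (A k) by rewrite mulr_ge0 ?enorm_ge0 // ltW ?kc.
  rewrite -(ger0_norm t0) -sqrtr_sqr -sqrtrM; last first.
    by apply: divr_ge0; [rewrite mulr_ge0 ?sqr_ge0|exact: ltW].
  rewrite ler_wsqrtr //.
  have -> : 2 * c ^+ 2 / rho0 * B = B / b by rewrite /b invf_div mulrC.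
  rewrite ler_pdivlMr //; apply: le_trans (bound k k0).
  rewrite exprMn enorm_sqr -exprM mulrC mulrA lerDr mulr_ge0 ?l0 // ltW ?kc //.
apply: limn_einf_eq0 => [|e e0 N].
  exists 1%N => // k /= k0; apply: mule_ge0; last exact: Fpos.
  by rewrite lee_fin mulr_ge0 ?sqr_ge0 ?sqrtr_ge0.
have [d d0 hd] := weighted_sqrt_small b0 C0 e0.
have [k] := small d d0 (maxn N (maxn N0 (Num.truncn (expR 1 : R)).+1)).
rewrite !geq_max => /and3P[Nk N0k ek] le.
have k0 : (0 < k)%N by exact: leq_trans ek.
exists k => //; apply: (@le_trans _ _ ((k%:R ^+ 2 * Num.sqrt (ln k%:R))%:E
    * (l k + (enorm ystar + Mg) * enorm (A k))%:E)%E).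
  by rewrite lee_wpmul2l ?F_le ?lee_fin ?mulr_ge0 ?sqr_ge0 ?sqrtr_ge0 //; exact: gK.
rewrite -EFinM lee_fin; apply: hd => //; [|exact: l0|exact: enorm_ge0].
by rewrite (le_trans (ltW (truncnS_gt _))) // ler_nat.
Qed.
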